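(* Let $k$ be a field of characteristic $0$, $X$ a smooth scheme over $k$, and let $\mathcal{A}=(\mathcal{A}^0,\mathcal{A}^{-1})$ be a Gerstenhaber algebra over $X$ living in degrees $-1,0$. Assigning to a BV structure on the Schouten algebra $S(\mathcal{A})$ the first component $\nabla^r:\mathcal{A}^{-1}\to\mathcal{A}^0$ of its differential, and assigning to a mapping $\nabla^r:\mathcal{A}^{-1}\to\mathcal{A}^0$ satisfying $$\nabla^r(a\tau)=a\nabla^r(\tau)-\tau(a)\qquad\text{for all } a\in\mathcal{A}^0,\ \tau\in\mathcal{A}^{-1}\qquad( * )$$ its unique extension to a differential $d$ on $S(\mathcal{A})$ making it a BV algebra, establish two mutually inverse bijections between the set of mappings $\nabla^r:\mathcal{A}^{-1}\to\mathcal{A}^0$ satisfying $( * )$ and the set of BV structures on $S(\mathcal{A})$. The extension $d$ is defined by the formula $$d(\tau_1\wedge\ldots\wedge\tau_p)=\sum_{j=1}^p(-1)^{j-1}\nabla^r(\tau_j)\,\tau_1\wedge\ldots\wedge\hat\tau_j\wedge\ldots\wedge\tau_p+\sum_{i<j}(-1)^{i+j}[\tau_i,\tau_j]\wedge\tau_1\wedge\ldots\wedge\hat\tau_i\wedge\ldots\wedge\hat\tau_j\wedge\ldots\wedge\tau_p$$ for $\tau_1,\dots,\tau_p\in\mathcal{A}^{-1}$.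
   Context: A Gerstenhaber algebra is a $\mathbb{Z}$-graded (graded-)commutative algebra $G^\bullet$ with a bracket $[\,,]$ of degree $1$ making $G^\bullet[-1]$ (where $(G[-1])^j=G^{j-1}$) a graded Lie algebra, so in particular $[a,b]=-(-1)^{(|a|-1)(|b|-1)}[b,a]$, and such that $[a,bc]=[a,b]c+(-1)^{(|a|-1)|b|}b[a,c]$ for homogeneous $a,b,c$. A Batalin-Vilkovisky (BV) algebra is a Gerstenhaber algebra $B^\bullet$ with a differential $d$ of degree $1$ (so $d^2=0$) such that $(-1)^{|a|}[a,b]=d(ab)-da\cdot b-(-1)^{|a|}a\cdot db$ for all homogeneous $a,b$. ''Over $X$'' means sheaves of such ($k$-linear) structures on $X$; mappings are $k$-linear maps of sheaves. A Gerstenhaber algebra over $X$ living in degrees $-1,0$ is the same as a sheaf of commutative algebras $\mathcal{A}^0$ together with a Lie algebroid $\mathcal{A}^{-1}$ over $\mathcal{A}^0$: $\mathcal{A}^{-1}$ is a sheaf of Lie algebras which is also an $\mathcal{A}^0$-module and acts on $\mathcal{A}^0$ by derivations, the action being written $\tau(a)=[\tau,a]$; the corresponding map $\mathcal{A}^{-1}\to\mathrm{Der}(\mathcal{A}^0)$ is $\mathcal{A}^0$-linear, and $[\tau,a\tau']=a[\tau,\tau']+\tau(a)\tau'$ for $a\in\mathcal{A}^0$, $\tau,\tau'\in\mathcal{A}^{-1}$. The Schouten algebra $S(\mathcal{A})$ is the graded commutative algebra $\Lambda^\bullet_{\mathcal{A}^0}(\mathcal{A}^{-1})$ (exterior algebra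 over $\mathcal{A}^0$, with $\mathcal{A}^0$ in degree $0$ and $\mathcal{A}^{-1}$ in degree $-1$), equipped with the unique Lie bracket of degree $1$ making it a Gerstenhaber algebra such that the obvious embedding $\mathcal{A}\hookrightarrow S(\mathcal{A})$ is a morphism of graded Lie algebras. A BV structure on $S(\mathcal{A})$ is a differential of degree $1$ on it making it a BV algebra; its first component is the component $\mathcal{A}^{-1}\to\mathcal{A}^0$.
   Formalization: ( * ) alone does not force d²=0, so the bijection is proved between maps satisfying ( * ) and degree-1 operators with the BV identity (d²=0 dropped), and between maps satisfying ( * ) and ∇[τ,τ']=τ(∇τ')−τ'(∇τ) and BV structures with d²=0. *)

(* Defs.v *)
From mathcomp Require Import all_boot all_order all_algebra.
From mathcomp Require Import boolp classical_sets topology.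

Set Implicit Arguments.
Unset Strict Implicit.
Unset Printing Implicit Defensive.

Import GRing.Theory.

Local Open Scope classical_set_scope.
Local Open Scope ring_scope.

Record opens (T : topologicalType) := Opens {
  oset :> set T;
  oset_open : open oset }.

(* Restriction maps take a proof of the inclusion as an argument. Sections that
   must agree on an overlap are compared on every open set contained in it;
   that is the same as comparing them on the intersection. *)
Definition is_sheaf (T : topologicalType) (F : opens T -> Type)
    (res : forall U V : opens T, V `<=` U -> F U -> F V) : Prop :=
  [/\ forall (U : opens T) (h : U `<=` U) (s : F U), res U U h s = s,
      forall (U V W : opens T) (hVU : V `<=` U) (hWV : W `<=` V)
        (hWU : W `<=` U) (s : F U),
        res V W hWV (res U V hVU s) = res U W hWU s
    & forall (U : opens T) (I : Type) (V : I -> opens T)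
        (hV : forall i, V i `<=` U),
        (forall x, oset U x -> exists i, oset (V i) x) ->
        forall s : forall i, F (V i),
        (forall i j (W : opens T) (hi : W `<=` V i) (hj : W `<=` V j),
           res (V i) W hi (s i) = res (V j) W hj (s j)) ->
        exists! t : F U, forall i, res U (V i) (hV i) t = s i].

Record sheaf (k : fieldType) (T : topologicalType) := Sheaf {
  sec :> opens T -> lmodType k;
  res : forall U V : opens T, V `<=` U -> sec U -> sec V;
  res_linear : forall (U V : opens T) (h : V `<=` U), linear (res h);
  res_sheaf : is_sheaf res }.

Record shom (k : fieldType) (T : topologicalType) (F G : sheaf k T) := Hom {
  hom_fun :> forall U : opens T, F U -> G U;
  hom_linear : forall U : opens T, linear (@hom_fun U);
  hom_res : forall (U V : opens T) (h : V `<=` U) (s : F U),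
    hom_fun (res h s) = res h (hom_fun s) }.

(* A commutative k-algebra. The MathComp structure [comAlgType] excludes the
   zero ring, which is the ring of functions on the empty open set. *)
Record kalg (k : fieldType) := Kalg {
  kalg_ring :> comPzRingType;
  kalg_str : {rmorphism k -> kalg_ring} }.

Definition is_kalg_morph (k : fieldType) (R R' : kalg k)
    (f : {rmorphism R -> R'}) : Prop :=
  forall c, f (kalg_str R c) = kalg_str R' c.

Definition is_prime_ideal (R : comPzRingType) (p : set R) : Prop :=
  [/\ p 0, forall x y, p x -> p y -> p (x + y),
      forall x y, p y -> p (x * y), ~ p 1
    & forall x y, p (x * y) -> p x \/ p y].

Definition is_localization (R R' : comPzRingType) (f : R)
    (rho : R -> R') : Prop :=
  [/\ exists g, rho f * g = 1,
      forall y, exists (x : R) (n : nat), y * rho f ^+ n = rho x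
    & forall x, rho x = 0 -> exists n : nat, f ^+ n * x = 0].

(* The ringed space (U, O|_U) is Spec R with R = O(U): the points of U are the
   primes of R through phi, the sets D(f) form a basis of the topology, and
   O(D(f)) = R_f. *)
Definition is_affine (k : fieldType) (T : topologicalType)
    (O : opens T -> kalg k)
    (Ores : forall U V : opens T, V `<=` U -> {rmorphism O U -> O V})
    (U : opens T) : Prop :=
  exists phi : T -> set (O U),
    let D (f : O U) := [set x | oset U x /\ ~ phi x f] in
    [/\ forall x, oset U x -> is_prime_ideal (phi x),
        forall x y, oset U x -> oset U y -> phi x = phi y -> x = y,
        forall p, is_prime_ideal p -> exists2 x, oset U x & phi x = p,
        forall V : set T, V `<=` U ->
          (open V <-> forall x, V x -> exists2 f, D f x & D f `<=` V)
      & forall (f : O U) (V : opens T) (h : V `<=` U), oset V = D f ->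
          is_localization f (Ores U V h)].

Definition fin_generated (k : fieldType) (R : kalg k) : Prop :=
  exists s : seq R, forall P : set R,
    (forall c, P (kalg_str R c)) -> (forall x, x \in s -> P x) ->
    (forall x y, P x -> P y -> P (x + y)) ->
    (forall x y, P x -> P y -> P (x * y)) -> forall x, P x.

(* infinitesimal lifting along surjections with square-zero kernel *)
Definition formally_smooth (k : fieldType) (R : kalg k) : Prop :=
  forall (B C : kalg k) (q : {rmorphism B -> C}) (g : {rmorphism R -> C}),
    is_kalg_morph q -> is_kalg_morph g ->
    (forall y, exists x, q x = y) ->
    (forall x y, q x = 0 -> q y = 0 -> x * y = 0) ->
    exists2 h : {rmorphism R -> B}, is_kalg_morph h & forall x, q (h x) = g x.

(* Smooth means locally of finite presentation and formally smooth; over a field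
   finite presentation is the same as finite generation. *)
Record smooth_scheme (k : fieldType) := SmoothScheme {
  ss_space :> topologicalType;
  ss_O : opens ss_space -> kalg k;
  ss_res : forall U V : opens ss_space, V `<=` U -> {rmorphism ss_O U -> ss_O V};
  ss_res_kalg : forall (U V : opens ss_space) (h : V `<=` U),
    is_kalg_morph (ss_res h);
  ss_sheaf : is_sheaf (fun U V (h : V `<=` U) => ss_res h : ss_O U -> ss_O V);
  ss_smooth : forall x : ss_space, exists U : opens ss_space,
    [/\ oset U x, is_affine ss_res U, fin_generated (ss_O U)
      & formally_smooth (ss_O U)] }.

(* In graded structures, an operation landing in degree i + j (or i + j + 1)
   takes the target degree l and a proof of the equation i + j = l; this avoids
   transports along equalities of degrees. *)
Record gralg (k : fieldType) (T : topologicalType) := GrAlg {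
  gr :> int -> sheaf k T;
  gmul : forall i j l : int, i + j = l ->
    forall U : opens T, gr i U -> gr j U -> gr l U;
  gone : forall U : opens T, gr 0 U;
  gmul_linear_l : forall i j l (e : i + j = l) (U : opens T) (b : gr j U),
    linear (fun a => gmul e a b);
  gmul_linear_r : forall i j l (e : i + j = l) (U : opens T) (a : gr i U),
    linear (fun b => gmul e a b);
  gmul_res : forall i j l (e : i + j = l) (U V : opens T) (h : V `<=` U)
    (a : gr i U) (b : gr j U),
    res h (gmul e a b) = gmul e (res h a) (res h b);
  gone_res : forall (U V : opens T) (h : V `<=` U), res h (gone U) = gone V;
  gmulA : forall i1 i2 i3 i12 i23 l (e12 : i1 + i2 = i12) (e : i12 + i3 = l)
    (e23 : i2 + i3 = i23) (e' : i1 + i23 = l) (U : opens T)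
    (a : gr i1 U) (b : gr i2 U) (c : gr i3 U),
    gmul e (gmul e12 a b) c = gmul e' a (gmul e23 b c);
  gmul1l : forall i (e : 0 + i = i) (U : opens T) (a : gr i U),
    gmul e (gone U) a = a;
  gmul1r : forall i (e : i + 0 = i) (U : opens T) (a : gr i U),
    gmul e a (gone U) = a }.

Record gralg_morph (k : fieldType) (T : topologicalType) (G H : gralg k T) :=
  GrAlgMorph {
  gmorph :> forall i : int, shom (G i) (H i);
  gmorphM : forall i j l (e : i + j = l) (U : opens T) (a : G i U) (b : G j U),
    gmorph l U (gmul e a b) = gmul e (gmorph i U a) (gmorph j U b);
  gmorph1 : forall U : opens T, gmorph 0 U (gone G U) = gone H U }.

Record gerstenhaber (k : fieldType) (T : topologicalType) := Gerstenhaber {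
  galg :> gralg k T;
  gcomm : forall i j l (e : i + j = l) (e' : j + i = l) (U : opens T)
    (a : galg i U) (b : galg j U),
    gmul e a b = (-1) ^ (i * j) *: gmul e' b a;
  br : forall i j l : int, i + j + 1 = l ->
    forall U : opens T, galg i U -> galg j U -> galg l U;
  br_linear_l : forall i j l (e : i + j + 1 = l) (U : opens T) (b : galg j U),
    linear (fun a => br e a b);
  br_linear_r : forall i j l (e : i + j + 1 = l) (U : opens T) (a : galg i U),
    linear (fun b => br e a b);
  br_res : forall i j l (e : i + j + 1 = l) (U V : opens T) (h : V `<=` U)
    (a : galg i U) (b : galg j U),
    res h (br e a b) = br e (res h a) (res h b);
  br_antisym : forall i j l (e : i + j + 1 = l) (e' : j + i + 1 = l)
    (U : opens T) (a : galg i U) (b : galg j U),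
    br e a b = - ((-1) ^ ((i - 1) * (j - 1)) *: br e' b a);
  br_jacobi : forall i1 i2 i3 i12 i13 i23 l
    (e12 : i1 + i2 + 1 = i12) (e13 : i1 + i3 + 1 = i13)
    (e23 : i2 + i3 + 1 = i23) (e1 : i1 + i23 + 1 = l)
    (e2 : i2 + i13 + 1 = l) (e3 : i12 + i3 + 1 = l)
    (U : opens T) (a : galg i1 U) (b : galg i2 U) (c : galg i3 U),
    br e1 a (br e23 b c) =
      br e3 (br e12 a b) c
      + (-1) ^ ((i1 - 1) * (i2 - 1)) *: br e2 b (br e13 a c);
  br_leibniz : forall i1 i2 i3 i12 i13 i23 l
    (e12 : i1 + i2 + 1 = i12) (e13 : i1 + i3 + 1 = i13)
    (e23 : i2 + i3 = i23) (e1 : i1 + i23 + 1 = l)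
    (e2 : i2 + i13 = l) (e3 : i12 + i3 = l)
    (U : opens T) (a : galg i1 U) (b : galg i2 U) (c : galg i3 U),
    br e1 a (gmul e23 b c) =
      gmul e3 (br e12 a b) c
      + (-1) ^ ((i1 - 1) * i2) *: gmul e2 b (br e13 a c) }.

(* An operator of degree 1 that generates the bracket; d^2 = 0 is imposed only in
   [bv_structure]. *)
Record bv_operator (k : fieldType) (T : topologicalType)
    (G : gerstenhaber k T) := BVOperator {
  bvd :> forall i j : int, i + 1 = j -> shom (G i) (G j);
  bvdP : forall i j i' j' n l (eij : i + j = n) (ebr : i + j + 1 = l)
    (ei : i + 1 = i') (ej : j + 1 = j') (en : n + 1 = l)
    (ei'j : i' + j = l) (eij' : i + j' = l)
    (U : opens T) (a : G i U) (b : G j U),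
    (-1) ^ i *: br ebr a b =
      bvd en U (gmul eij a b) - gmul ei'j (bvd ei U a) b
      - (-1) ^ i *: gmul eij' a (bvd ej U b) }.

Record bv_structure (k : fieldType) (T : topologicalType)
    (G : gerstenhaber k T) := BVStructure {
  bvs_op :> bv_operator G;
  bvs_sq0 : forall i j l (e : i + 1 = j) (e' : j + 1 = l) (U : opens T)
    (a : G i U), bvs_op j l e' U (bvs_op i j e U a) = 0 }.

Definition in_degrees_m1_0 (k : fieldType) (T : topologicalType)
    (A : gerstenhaber k T) : Prop :=
  forall n : int, n <> -1 -> n <> 0 ->
  forall (U : opens T) (x : A n U), x = 0.

(* The action of A^{-1} on A^0 is tau(a) = [tau, a]. *)
Record right_conn (k : fieldType) (T : topologicalType)
    (A : gerstenhaber k T) := RightConn {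
  nabla :> shom (A (-1)) (A 0);
  nablaP : forall (e : 0 + -1 = -1) (e0 : 0 + 0 = 0) (ebr : -1 + 0 + 1 = 0)
    (U : opens T) (a : A 0 U) (tau : A (-1) U),
    nabla U (gmul e a tau) = gmul e0 a (nabla U tau) - br ebr tau a }.

(* Flatness: d (d (tau /\ tau')) = 0 for the operator d extending nabla. The
   Leibniz rule of [right_conn] alone does not give it. *)
Record integrable_right_conn (k : fieldType) (T : topologicalType)
    (A : gerstenhaber k T) := IntegrableRightConn {
  irc_conn :> right_conn A;
  irc_flat : forall (e : -1 + -1 + 1 = -1) (e0 : -1 + 0 + 1 = 0)
    (U : opens T) (tau tau' : A (-1) U),
    irc_conn U (br e tau tau') =
      br e0 tau (irc_conn U tau') - br e0 tau' (irc_conn U tau) }.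

(* f0 makes B an A^0-algebra, and f1 is an A^0-linear map with f1(tau)^2 = 0 *)
Definition is_exterior_map (k : fieldType) (T : topologicalType)
    (A : gerstenhaber k T) (B : gralg k T)
    (f0 : shom (A 0) (B 0)) (f1 : shom (A (-1)) (B (-1))) : Prop :=
  [/\ forall U : opens T, f0 U (gone A U) = gone B U,
      forall (e : 0 + 0 = 0) (U : opens T) (a b : A 0 U),
        f0 U (gmul e a b) = gmul e (f0 U a) (f0 U b),
      forall n (e : 0 + n = n) (e' : n + 0 = n) (U : opens T)
        (a : A 0 U) (x : B n U), gmul e (f0 U a) x = gmul e' x (f0 U a),
      forall (e : 0 + -1 = -1) (U : opens T) (a : A 0 U) (tau : A (-1) U),
        f1 U (gmul e a tau) = gmul e (f0 U a) (f1 U tau)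
    & forall l (e : -1 + -1 = l) (U : opens T) (tau : A (-1) U),
        gmul e (f1 U tau) (f1 U tau) = 0].

(* The universal property of the sheaf of exterior algebras of A^{-1} over A^0.
   The sheaf is not the presheaf U |-> Lambda(A^{-1}(U)) but its sheafification,
   and this is what the universal property among sheaves of algebras says. *)
Definition is_exterior_algebra (k : fieldType) (T : topologicalType)
    (A : gerstenhaber k T) (S : gralg k T)
    (i0 : shom (A 0) (S 0)) (i1 : shom (A (-1)) (S (-1))) : Prop :=
  is_exterior_map i0 i1 /\
  forall (B : gralg k T) (f0 : shom (A 0) (B 0)) (f1 : shom (A (-1)) (B (-1))),
    is_exterior_map f0 f1 ->
    exists! phi : gralg_morph S B,
      (forall (U : opens T) (a : A 0 U), phi 0 U (i0 U a) = f0 U a) /\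
      (forall (U : opens T) (tau : A (-1) U), phi (-1) U (i1 U tau) = f1 U tau).

(* The four bracket conditions say that the inclusion of A is a morphism of
   graded Lie algebras; [a, b] = 0 in A for a and b of degree 0. *)
Record schouten (k : fieldType) (T : topologicalType)
    (A : gerstenhaber k T) := Schouten {
  sch_alg :> gerstenhaber k T;
  sch0 : shom (A 0) (sch_alg 0);
  sch1 : shom (A (-1)) (sch_alg (-1));
  sch_ext : is_exterior_algebra sch0 sch1;
  sch_br11 : forall (e : -1 + -1 + 1 = -1) (U : opens T) (s t : A (-1) U),
    sch1 U (br e s t) = br e (sch1 U s) (sch1 U t);
  sch_br10 : forall (e : -1 + 0 + 1 = 0) (U : opens T)
    (t : A (-1) U) (a : A 0 U),
    sch0 U (br e t a) = br e (sch1 U t) (sch0 U a);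
  sch_br01 : forall (e : 0 + -1 + 1 = 0) (U : opens T)
    (a : A 0 U) (t : A (-1) U),
    sch0 U (br e a t) = br e (sch0 U a) (sch1 U t);
  sch_br00 : forall l (e : 0 + 0 + 1 = l) (U : opens T) (a b : A 0 U),
    br e (sch0 U a) (sch0 U b) = 0 }.

Lemma deg_add0 (n : int) : 0 + n = n.
Proof. exact: add0r. Qed.

Lemma deg_wedge (p : nat) : -1 + - p%:Z = - p.+1%:Z.
Proof. by rewrite -[RHS]/(- (p.+1)%:Z) -add1n PoszD opprD. Qed.

Lemma deg_diff (p : nat) : - p.+1%:Z + 1 = - p%:Z.
Proof. by rewrite -deg_wedge addrAC addNr add0r. Qed.

Lemma deg_hat2 (p : nat) (i : 'I_p) : -1 + - p.-1%:Z = - p%:Z.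
Proof. by case: p i => [[]|p _] //; rewrite deg_wedge. Qed.

Lemma deg_brT : -1 + -1 + 1 = -1 :> int.
Proof. by []. Qed.

Lemma deg_d1 : -1 + 1 = 0 :> int.
Proof. by []. Qed.

Section Wedge.
Context (k : fieldType) (T : topologicalType) (A : gerstenhaber k T).
Context (S : schouten A) (U : opens T).

Fixpoint wedge (p : nat) : ('I_p -> A (-1) U) -> S (- p%:Z) U :=
  match p with
  | 0%N => fun _ => gone S U
  | p'.+1 => fun tau =>
      gmul (deg_wedge p') (sch1 S U (tau ord0))
        (wedge (fun m => tau (lift ord0 m)))
  end.

(* Indices start at 0. For i < j the index [lift j i] has value i, and the family
   [tau (lift j (lift i m))] omits the entries i and j of tau. *)
Definition bv_formula (nb : right_conn A) (p : nat)
    (tau : 'I_p.+1 -> A (-1) U) : S (- p%:Z) U :=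
  \sum_(j < p.+1) (-1) ^+ j *:
     gmul (deg_add0 (- p%:Z)) (sch0 S U (nb U (tau j)))
       (wedge (fun m => tau (lift j m)))
  + \sum_(j < p.+1) \sum_(i < p | (i < j)%N) (-1) ^+ (i + j) *:
     gmul (deg_hat2 i) (sch1 S U (br deg_brT (tau (lift j i)) (tau j)))
       (wedge (fun m => tau (lift j (lift i m)))).

End Wedge.

(* Main.v *)
(** A BV operator on a Gerstenhaber algebra G is the same thing as an algebra
    section of a first-order deformation of G: on G + eps G, with eps of degree
    -1, the product
      (x, u)(y, v) = (xy, uy + (-1)^|x| (xv + [x, y]))
    is associative because the bracket is a biderivation, and x |-> (x, dx) is
    multiplicative exactly when d satisfies the BV identity. For the Schouten
    algebra S the universal property produces such sections out of maps on A,
    and (a, 0), (tau, nabla tau) satisfy the relations of the exterior algebra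
    exactly when nabla satisfies the right Leibniz rule.

    For the squares: since d(tau x) = nabla(tau) x - tau dx - [tau, x] and
    d(ax) = a dx + [a, x], the vanishing of d^2 reduces to
      d[tau, x] = [nabla tau, x] + [tau, dx]   and   d[a, x] = - [a, dx],
    which propagate from 1 to all of S along multiplication by tau (this is
    where flatness is used) and by a. *)

Require Import Defs.
From HB Require Import structures.
From mathcomp Require Import all_boot all_order all_algebra.
From mathcomp Require Import boolp classical_sets topology.
From mathcomp Require Import zify ring.

Set Implicit Arguments.
Unset Strict Implicit.
Unset Printing Implicit Defensive.

Import GRing.Theory.

Local Open Scope classical_set_scope.
Local Open Scope ring_scope.

(** * Sheaves of submodules and graded subalgebras *)

Section LinearMaps.
Context (k : fieldType) (V W : lmodType k) (f : V -> W) (lf : linear f).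

Lemma lin0 : f 0 = 0.
Proof.
have := congr1 (+%R^~ (- f 0)) (lf 1 0 0).
by rewrite !scale1r addr0 subrr addrK.
Qed.

Lemma linD u v : f (u + v) = f u + f v.
Proof. by rewrite -[u in LHS]scale1r lf scale1r. Qed.

Lemma linZ c u : f (c *: u) = c *: f u.
Proof. by rewrite -[X in f X]addr0 lf lin0 addr0. Qed.

Lemma linN u : f (- u) = - f u.
Proof. by rewrite -scaleN1r linZ scaleN1r. Qed.

Lemma linB u v : f (u - v) = f u - f v.
Proof. by rewrite linD linN. Qed.

Lemma lin_sum (I : Type) (r : seq I) (P : pred I) (F : I -> V) :
  f (\sum_(i <- r | P i) F i) = \sum_(i <- r | P i) f (F i).
Proof. by apply: (big_morph f linD lin0). Qed.

End LinearMaps.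

Section Submodules.
Context (k : fieldType) (V : lmodType k).

(** Membership is [Prop]-valued, so arbitrary properties of sections qualify; [sm_pred] makes it
    boolean classically, which lets [subm] inherit its [lmodType] structure. *)
Record submod := Submod {
  sm_set :> V -> Prop;
  sm_set0 : sm_set 0;
  sm_setP : forall c x y, sm_set x -> sm_set y -> sm_set (c *: x + y) }.

Definition sm_pred (M : submod) : {pred V} := [pred x | `[< M x >]].

Lemma sm_pred_closed M : submod_closed (sm_pred M).
Proof.
split; first by apply/asboolP; exact: sm_set0.
by move=> c x y /asboolP hx /asboolP hy; apply/asboolP; exact: sm_setP.
Qed.

HB.instance Definition _ M :=
  GRing.isSubmodClosed.Build k V (sm_pred M) (sm_pred_closed M).

Record subm (M : submod) := Subm { sm_val :> V; _ : sm_val \in sm_pred M }.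

HB.instance Definition _ M := [isSub for @sm_val M].
HB.instance Definition _ M := [Choice of subm M by <:].
HB.instance Definition _ M := [SubChoice_isSubLmodule of subm M by <:].

Lemma sm_valP M (x : subm M) : M x.
Proof. by case: x => x hx; apply/asboolP. Qed.

Definition sm_sub (M : submod) (x : V) (hx : M x) : subm M := Subm (asboolT hx).

Lemma sm_val_inj M : injective (@sm_val M).
Proof. exact: val_inj. Qed.

End Submodules.

Definition covers (T : topologicalType) (U : opens T) (I : Type)
    (V : I -> opens T) :=
  forall x, oset U x -> exists i, oset (V i) x.

Section Sheaves.
Context (k : fieldType) (T : topologicalType).
Implicit Types (F G H : sheaf k T) (U V W : opens T).

Lemma res_id F U (h : U `<=` U) (s : F U) : res h s = s.
Proof. by case: (res_sheaf F). Qed.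

Lemma res_comp F U V W (hVU : V `<=` U) (hWV : W `<=` V) (hWU : W `<=` U)
    (s : F U) : res hWV (res hVU s) = res hWU s.
Proof. by case: (res_sheaf F). Qed.

Lemma sheaf_sep F U (I : Type) (V : I -> opens T) (hV : forall i, V i `<=` U)
    (s t : F U) :
  covers U V -> (forall i, res (hV i) s = res (hV i) t) -> s = t.
Proof.
move=> cov st; case: (res_sheaf F) => _ _ /(_ U I V hV cov).
case/(_ (fun i => res (hV i) s)) => [i j W hi hj|r [_ r_uniq]].
  by rewrite !(res_comp _ _ (subset_trans hi (hV i))).
by rewrite -(r_uniq s) // -(r_uniq t).
Qed.

Lemma sheaf_glue F U (I : Type) (V : I -> opens T) (hV : forall i, V i `<=` U)
    (s : forall i, F (V i)) :
  covers U V ->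
  (forall i j W (hi : W `<=` V i) (hj : W `<=` V j),
    res hi (s i) = res hj (s j)) ->
  exists t : F U, forall i, res (hV i) t = s i.
Proof.
move=> cov hs; case: (res_sheaf F) => _ _ /(_ U I V hV cov s hs).
by case=> t [ht _]; exists t.
Qed.

Lemma is_sheafI (F : opens T -> Type)
    (rs : forall U V, V `<=` U -> F U -> F V) :
  (forall U (h : U `<=` U) s, rs U U h s = s) ->
  (forall U V W (hVU : V `<=` U) (hWV : W `<=` V) (hWU : W `<=` U) s,
     rs V W hWV (rs U V hVU s) = rs U W hWU s) ->
  (forall U (I : Type) (V : I -> opens T) (hV : forall i, V i `<=` U) s t,
     covers U V -> (forall i, rs U (V i) (hV i) s = rs U (V i) (hV i) t) ->
     s = t) ->
  (forall U (I : Type) (V : I -> opens T) (hV : forall i, V i `<=` U)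
     (s : forall i, F (V i)), covers U V ->
     (forall i j W (hi : W `<=` V i) (hj : W `<=` V j),
        rs (V i) W hi (s i) = rs (V j) W hj (s j)) ->
     exists t, forall i, rs U (V i) (hV i) t = s i) ->
  is_sheaf rs.
Proof.
move=> hid hcomp hsep hglue; split=> // U I V hV cov s hs.
have [t ht] := hglue U I V hV s cov hs; exists t; split=> // t' ht'.
by apply: (hsep U I V hV) => // i; rewrite ht ht'.
Qed.

Section SheafLinear.
Context (F G : sheaf k T) (f : shom F G) (U : opens T).

Lemma hom0 : f U 0 = 0. Proof. exact: lin0 (@hom_linear _ _ _ _ f U). Qed.
Lemma homD u v : f U (u + v) = f U u + f U v.
Proof. exact: linD (@hom_linear _ _ _ _ f U) _ _. Qed.
Lemma homN u : f U (- u) = - f U u.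
Proof. exact: linN (@hom_linear _ _ _ _ f U) _. Qed.
Lemma homB u v : f U (u - v) = f U u - f U v.
Proof. exact: linB (@hom_linear _ _ _ _ f U) _ _. Qed.
Lemma homZ c u : f U (c *: u) = c *: f U u.
Proof. exact: linZ (@hom_linear _ _ _ _ f U) _ _. Qed.

Lemma res0 V (h : V `<=` U) : res h (0 : F U) = 0.
Proof. exact: lin0 (res_linear h). Qed.
Lemma resD V (h : V `<=` U) (u v : F U) : res h (u + v) = res h u + res h v.
Proof. exact: linD (res_linear h) _ _. Qed.
Lemma resN V (h : V `<=` U) (u : F U) : res h (- u) = - res h u.
Proof. exact: linN (res_linear h) _. Qed.
Lemma resZ V (h : V `<=` U) c (u : F U) : res h (c *: u) = c *: res h u.
Proof. exact: linZ (res_linear h) _ _. Qed.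

End SheafLinear.

Definition opens_I U V : opens T := Opens (openI (oset_open U) (oset_open V)).

Definition hom_id F : shom F F :=
  Defs.Hom (hom_fun := fun U s => s) (fun U c u v => erefl)
    (fun U V h s => erefl).

Definition hom_zero F G : shom F G.
Proof.
exists (fun U s => 0); first by move=> U c u v; rewrite scaler0 addr0.
by move=> U V h s; rewrite res0.
Defined.

Definition hom_comp F G H (g : shom G H) (f : shom F G) : shom F H.
Proof.
exists (fun U s => g U (f U s)); first by move=> U c u v; rewrite !hom_linear.
by move=> U V h s; rewrite !hom_res.
Defined.

Lemma shom_eq F G (f g : shom F G) : (forall U s, f U s = g U s) -> f = g.
Proof.
case: f g => [f lf rf] [g lg rg] /= fg.
have e : f = g by apply: functional_extensionality_dep => U; apply/funext/fg.
by case: g / e lg rg fg => lg rg _; congr Defs.Hom; exact: Prop_irrelevance.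
Qed.

Definition prod_sheaf F G : sheaf k T.
Proof.
apply: (@Sheaf k T (fun U => (F U * G U)%type)
  (fun U V h s => (res h s.1, res h s.2))).
  by move=> U V h c [s t] [s' t'] /=; rewrite !res_linear.
apply: is_sheafI => /=.
- by move=> U h [s t]; rewrite !res_id.
- by move=> U V W hVU hWV hWU [s t]; rewrite /= !(res_comp _ _ hWU).
- move=> U I V hV [s s'] [t t'] cov /= st.
  by congr (_, _); apply: (sheaf_sep (hV := hV)) => // i; case: (st i).
move=> U I V hV s cov hs.
have [|t ht] := sheaf_glue (s := fun i => (s i).1) hV cov.
  by move=> i j W hi hj; case: (hs i j W hi hj).
have [|t' ht'] := sheaf_glue (s := fun i => (s i).2) hV cov.
  by move=> i j W hi hj; case: (hs i j W hi hj).
by exists (t, t') => i /=; rewrite ht ht'; case: (s i).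
Defined.

End Sheaves.

Section GradedAlgebras.
Context (k : fieldType) (T : topologicalType).
Implicit Types (G H : gralg k T) (U V W : opens T).

Definition gr_id G : gralg_morph G G.
Proof. by exists (fun i => hom_id (G i)). Defined.

Definition gr_comp G H K (g : gralg_morph H K) (f : gralg_morph G H) :
  gralg_morph G K.
Proof.
exists (fun i => hom_comp (g i) (f i)) => /=.
  by move=> i j l e U a b; rewrite !gmorphM.
by move=> U; rewrite !gmorph1.
Defined.

(** Locality [sf_loc] keeps glued sections inside the family, so that the submodules form a
    subsheaf. *)
Record subfamily G := SubFamily {
  sf_submod :> forall n U, submod (G n U);
  sf_res : forall n U V (h : V `<=` U) (x : G n U),
    sf_submod n U x -> sf_submod n V (res h x);
  sf_loc : forall n U (I : Type) (V : I -> opens T)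
    (hV : forall i, V i `<=` U) (x : G n U),
    covers U V -> (forall i, sf_submod n (V i) (res (hV i) x)) ->
    sf_submod n U x }.

Definition sub_sheaf G (P : subfamily G) (n : int) : sheaf k T.
Proof.
apply: (@Sheaf k T (fun U => subm (P n U))
  (fun U V h s => sm_sub (sf_res h (sm_valP s)))).
  by move=> U V h c s t; apply: sm_val_inj; rewrite /= res_linear.
apply: is_sheafI => /=.
- by move=> U h s; apply: sm_val_inj; rewrite /= res_id.
- move=> U V W hVU hWV hWU s; apply: sm_val_inj.
  by rewrite /= (res_comp _ _ hWU).
- move=> U I V hV s t cov /= st; apply: sm_val_inj.
  apply: (sheaf_sep (hV := hV)) => // i.
  exact: (congr1 (@sm_val _ _ _) (st i)).
move=> U I V hV s cov hs.
have [|t ht] := sheaf_glue (s := fun i => s i : G n (V i)) hV cov.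
  by move=> i j W hi hj; exact: (congr1 (@sm_val _ _ _) (hs i j W hi hj)).
have Pt : P n U t by apply: (sf_loc cov) => i; rewrite ht; exact: sm_valP.
by exists (sm_sub Pt) => i; apply: sm_val_inj; rewrite /= ht.
Defined.

Definition sub_lift G (P : subfamily G) (F : sheaf k T) n (f : shom F (G n))
    (Pf : forall U s, P n U (f U s)) : shom F (sub_sheaf P n).
Proof.
exists (fun U s => sm_sub (Pf U s)).
  by move=> U c u v; apply: sm_val_inj; rewrite /= hom_linear.
by move=> U V h s; apply: sm_val_inj; rewrite /= hom_res.
Defined.

Definition subfamily_alg G (P : subfamily G) :=
  (forall U, P 0 U (gone G U)) /\
  (forall i j l (e : i + j = l) U (a : G i U) (b : G j U),
    P i U a -> P j U b -> P l U (gmul e a b)).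

Definition sub_gralg G (P : subfamily G) (hP : subfamily_alg P) : gralg k T.
Proof.
apply: (@GrAlg k T (sub_sheaf P)
  (fun i j l e U a b => sm_sub (hP.2 i j l e U _ _ (sm_valP a) (sm_valP b)))
  (fun U => sm_sub (hP.1 U))).
- by move=> i j l e U b c a a'; apply: sm_val_inj; rewrite /= gmul_linear_l.
- by move=> i j l e U b c a a'; apply: sm_val_inj; rewrite /= gmul_linear_r.
- by move=> i j l e U V h a b; apply: sm_val_inj; rewrite /= gmul_res.
- by move=> U V h; apply: sm_val_inj; rewrite /= gone_res.
- move=> i1 i2 i3 i12 i23 l e12 e e23 e' U a b c.
  by apply: sm_val_inj; rewrite /= (gmulA _ _ e23 e').
- by move=> i e U a; apply: sm_val_inj; rewrite /= gmul1l.
- by move=> i e U a; apply: sm_val_inj; rewrite /= gmul1r.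
Defined.

Definition sub_incl G (P : subfamily G) (hP : subfamily_alg P) :
  gralg_morph (sub_gralg hP) G.
Proof.
by exists (fun i => @Defs.Hom _ _ (sub_gralg hP i) (G i)
  (fun U s => s : G i U) (fun U c u v => erefl) (fun U V h s => erefl)).
Defined.

End GradedAlgebras.

(** * Gerstenhaber calculus and the deformation *)

Section Sign.
Context (k : fieldType).

Lemma sgnD (m n : int) : (-1) ^ (m + n) = (-1) ^ m * (-1) ^ n :> k.
Proof. by rewrite exprzDr // unitrN1. Qed.

Lemma sgnS (m : int) : (-1) ^ (m + 1) = - (-1) ^ m :> k.
Proof. by rewrite sgnD expr1z mulrN1. Qed.

(** The caller supplies half the difference of the exponents; what remains is a polynomial identity,
    with no parity argument. *)
Lemma sgn_parity (q m n : int) : m = n + q * 2 -> (-1) ^ m = (-1) ^ n :> k.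
Proof.
move=> ->; rewrite sgnD mulrC [q * 2]mulrC -exprz_exp -exprnP sqrrN.
by rewrite expr1n exp1rz mul1r.
Qed.

End Sign.

(** Degree proofs for multiplication and bracket by degrees -1 and 0. In [deg_lower] the right
    factor has degree n + 1, so that the product lands in the plain variable n. *)
Lemma deg_lower (n : int) : -1 + (n + 1) = n. Proof. by ring. Qed.
Lemma deg_brt (n : int) : -1 + n + 1 = n. Proof. by ring. Qed.
Lemma deg_bra (n : int) : 0 + n + 1 = n + 1. Proof. by ring. Qed.

Section GerstenhaberCalculus.
Context (k : fieldType) (T : topologicalType).
Implicit Types (U V W : opens T).

Section Mul.
Context (G : gralg k T) (i j l : int) (e : i + j = l) (U : opens T).
Implicit Types (a : G i U) (b : G j U).

Lemma gmul0l b : gmul e 0 b = 0. Proof. exact: lin0 (gmul_linear_l e b). Qed.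
Lemma gmul0r a : gmul e a 0 = 0. Proof. exact: lin0 (gmul_linear_r e a). Qed.
Lemma gmulDl a a' b : gmul e (a + a') b = gmul e a b + gmul e a' b.
Proof. exact: linD (gmul_linear_l e b) _ _. Qed.
Lemma gmulDr a b b' : gmul e a (b + b') = gmul e a b + gmul e a b'.
Proof. exact: linD (gmul_linear_r e a) _ _. Qed.
Lemma gmulNl a b : gmul e (- a) b = - gmul e a b.
Proof. exact: linN (gmul_linear_l e b) _. Qed.
Lemma gmulNr a b : gmul e a (- b) = - gmul e a b.
Proof. exact: linN (gmul_linear_r e a) _. Qed.
Lemma gmulBl a a' b : gmul e (a - a') b = gmul e a b - gmul e a' b.
Proof. exact: linB (gmul_linear_l e b) _ _. Qed.
Lemma gmulZl c a b : gmul e (c *: a) b = c *: gmul e a b.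
Proof. exact: linZ (gmul_linear_l e b) _ _. Qed.
Lemma gmulZr c a b : gmul e a (c *: b) = c *: gmul e a b.
Proof. exact: linZ (gmul_linear_r e a) _ _. Qed.

Lemma gmul_irr (e' : i + j = l) a b : gmul e a b = gmul e' a b.
Proof. by rewrite (Prop_irrelevance e e'). Qed.

End Mul.

Section Bracket.
Context (G : gerstenhaber k T) (i j l : int) (e : i + j + 1 = l) (U : opens T).
Implicit Types (a : G i U) (b : G j U).

Lemma br0l b : br e 0 b = 0. Proof. exact: lin0 (br_linear_l e b). Qed.
Lemma br0r a : br e a 0 = 0. Proof. exact: lin0 (br_linear_r e a). Qed.
Lemma brDr a b b' : br e a (b + b') = br e a b + br e a b'.
Proof. exact: linD (br_linear_r e a) _ _. Qed.
Lemma brBr a b b' : br e a (b - b') = br e a b - br e a b'.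
Proof. exact: linB (br_linear_r e a) _ _. Qed.
Lemma brZr c a b : br e a (c *: b) = c *: br e a b.
Proof. exact: linZ (br_linear_r e a) _ _. Qed.

Lemma br_irr (e' : i + j + 1 = l) a b : br e a b = br e' a b.
Proof. by rewrite (Prop_irrelevance e e'). Qed.

End Bracket.

(** Antisymmetry moves the product into the second slot, where [br_leibniz] applies; swapping back
    leaves only a comparison of signs. *)
Lemma br_leibniz_l (G : gerstenhaber k T) (i1 i2 i3 i12 i13 i23 l : int)
    (e12 : i1 + i2 = i12) (e13 : i1 + i3 + 1 = i13) (e23 : i2 + i3 + 1 = i23)
    (e1 : i1 + i23 = l) (e2 : i2 + i13 = l) (e3 : i12 + i3 + 1 = l)
    U (a : G i1 U) (b : G i2 U) (c : G i3 U) :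
  br e3 (gmul e12 a b) c =
    gmul e1 a (br e23 b c) + (-1) ^ (i1 * i2) *: gmul e2 b (br e13 a c).
Proof.
have f12 : i3 + i1 + 1 = i13 by lia.
have f13 : i3 + i2 + 1 = i23 by lia.
have f1 : i3 + i12 + 1 = l by lia.
have f3 : i13 + i2 = l by lia.
rewrite (br_antisym e3 f1) (br_leibniz f12 f13 e12 f1 e1 f3).
rewrite (br_antisym e23 f13) (br_antisym e13 f12) (gcomm f3 e2).
rewrite !(gmulNr, gmulZr) scalerDr opprD addrC; congr (_ + _).
  rewrite scalerA -sgnD; congr (- (_ *: _)).
  apply: (@sgn_parity _ (i3 * i1 - i1)); rewrite -e12; ring.
rewrite scalerN scalerA scalerA -!sgnD; congr (- (_ *: _)).
apply: (@sgn_parity _ (i2 * i3)); rewrite -?e12 -?e13.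
ring.
Qed.

(** The Leibniz rule for [a, 1 * 1] gives [a, 1] = [a, 1] + [a, 1]. *)
Lemma br1r (G : gerstenhaber k T) i l (e : i + 0 + 1 = l) U (a : G i U) :
  br e a (gone G U) = 0.
Proof.
have e3 : l + 0 = l by lia.
have e2 : 0 + l = l by lia.
have := br_leibniz e e (addr0 0) e e2 e3 a (gone G U) (gone G U).
rewrite mulr0 expr0z scale1r !gmul1l gmul1r.
move/(congr1 (+%R^~ (- br e a (gone G U)))).
by rewrite subrr addrK.
Qed.

Lemma br1l (G : gerstenhaber k T) i l (e : 0 + i + 1 = l) U (a : G i U) :
  br e (gone G U) a = 0.
Proof.
have e' : i + 0 + 1 = l by lia.
by rewrite (br_antisym e e') br1r scaler0 oppr0.
Qed.

Section LowDegreeBrackets.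
Variable G : gerstenhaber k T.
Implicit Types n j l : int.

(** The sign exponent (-1 - 1) * j is even, so bracketing with degree -1 is a derivation without
    signs; the same happens for the Jacobi identity in [brt_br]. *)
Lemma brt_gmul j n l (e : j + n = l) U (t : G (-1) U) (y : G j U) (z : G n U) :
  br (deg_brt l) t (gmul e y z) =
    gmul e (br (deg_brt j) t y) z + gmul e y (br (deg_brt n) t z).
Proof.
rewrite (br_leibniz (deg_brt j) (deg_brt n) e _ e e).
by rewrite (@sgn_parity _ (- j) _ 0) ?expr0z ?scale1r //; ring.
Qed.

Lemma brt_br j n l (e : j + n + 1 = l) U (t : G (-1) U) (y : G j U)
    (z : G n U) :
  br (deg_brt l) t (br e y z) =
    br e (br (deg_brt j) t y) z + br e y (br (deg_brt n) t z).
Proof.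
rewrite (br_jacobi (deg_brt j) (deg_brt n) e _ e e).
by rewrite (@sgn_parity _ (1 - j) _ 0) ?expr0z ?scale1r //; ring.
Qed.

Lemma br01 U (a : G 0 U) (t : G (-1) U) (e : 0 + -1 + 1 = 0) :
  br e a t = - br (deg_brt 0) t a.
Proof.
rewrite (br_antisym e (deg_brt 0)) (@sgn_parity _ 1 _ 0 erefl).
by rewrite expr0z scale1r.
Qed.

(** In a Schouten algebra the assumption on [a, b] holds because degree 1 vanishes. *)
Lemma bra_gmul0 n U (a b : G 0 U) (x : G n U) :
  br (deg_bra 0) a b = 0 ->
  br (deg_bra n) a (gmul (deg_add0 n) b x) =
    gmul (deg_add0 (n + 1)) b (br (deg_bra n) a x).
Proof.
move=> ab; have e : 0 + 1 + n = n + 1 by ring.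
rewrite (br_leibniz (deg_bra 0) (deg_bra n) _ _ (deg_add0 (n + 1)) e).
by rewrite ab gmul0l add0r mulr0 expr0z scale1r.
Qed.

Lemma bra_gmul1 n U (a : G 0 U) (t : G (-1) U) (x : G (n + 1) U) :
  br (deg_bra n) a (gmul (deg_lower n) t x) =
    - gmul (deg_add0 (n + 1)) (br (deg_brt 0) t a) x
    - gmul (deg_lower (n + 1)) t (br (deg_bra (n + 1)) a x).
Proof.
rewrite (br_leibniz (deg_bra (-1)) (deg_bra (n + 1)) _ _ (deg_lower (n + 1))
  (deg_add0 (n + 1))).
rewrite br01 gmulNl (@sgn_parity _ 0 _ 1 erefl) expr1z scaleN1r.
by [].
Qed.

Lemma bra_bra n U (a b : G 0 U) (x : G n U) : br (deg_bra 0) a b = 0 ->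
  br (deg_bra (n + 1)) a (br (deg_bra n) b x) =
    - br (deg_bra (n + 1)) b (br (deg_bra n) a x).
Proof.
move=> ab; have e : 0 + 1 + n + 1 = n + 1 + 1 by ring.
rewrite (br_jacobi (deg_bra 0) (deg_bra n) _ _ (deg_bra (n + 1)) e).
by rewrite ab br0l add0r (@sgn_parity _ 0 _ 1 erefl) expr1z scaleN1r.
Qed.

End LowDegreeBrackets.

(** * The first-order deformation of a Gerstenhaber algebra *)

Lemma deg_def1 (i j l : int) : i + j = l -> i + 1 + j = l + 1.
Proof. by move=> <-; ring. Qed.

Lemma deg_def2 (i j l : int) : i + j = l -> i + (j + 1) = l + 1.
Proof. by move=> <-; ring. Qed.

Lemma deg_def3 (i j l : int) : i + j = l -> i + j + 1 = l + 1.
Proof. by move=> <-. Qed.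

Section Deformation.
Variable G : gerstenhaber k T.

Definition def_mul (i j l : int) (e : i + j = l) U
    (p : G i U * G (i + 1) U) (q : G j U * G (j + 1) U) :
    G l U * G (l + 1) U :=
  (gmul e p.1 q.1,
   gmul (deg_def1 e) p.2 q.1
   + (-1) ^ i *: (gmul (deg_def2 e) p.1 q.2 + br (deg_def3 e) p.1 q.1)).

Definition deformation : gralg k T.
Proof.
apply: (@GrAlg k T (fun i => prod_sheaf (G i) (G (i + 1)))
  (fun i j l e U p q => def_mul e p q) (fun U => (gone G U, 0))).
- move=> i j l e U [y v] c [x u] [x' u']; rewrite /def_mul /=.
  congr (_, _) => /=; first by rewrite gmul_linear_l.
  rewrite !gmul_linear_l br_linear_l !(scalerDr, addrA, scalerA) /=.
  by rewrite ![c * _]mulrC (ACl (1*3*5*2*4*6)).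
- move=> i j l e U [x u] c [y v] [y' v']; rewrite /def_mul /=.
  congr (_, _) => /=; first by rewrite gmul_linear_r.
  rewrite !gmul_linear_r br_linear_r !(scalerDr, addrA, scalerA) /=.
  by rewrite ![c * _]mulrC (ACl (1*3*5*2*4*6)).
- move=> i j l e U V h [x u] [y v]; rewrite /def_mul /=.
  congr (_, _) => /=; first by rewrite gmul_res.
  by rewrite !(resD, resZ)
     !gmul_res br_res.
- by move=> U V h /=; rewrite gone_res res0.
- move=> i1 i2 i3 i12 i23 l e12 e e23 e' U [x u] [y v] [z w].
  rewrite /def_mul /=; congr (_, _) => /=; first exact: gmulA.
  have f12 : i1 + i2 + 1 = i12 + 1 by rewrite e12.
  have f23 : i2 + i3 + 1 = i23 + 1 by rewrite e23.
  (* The degree of y[x, z], a term produced both by [xy, z] on the left and by [x, yz] on the right,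
     with signs that agree. *)
  have f13 : i2 + (i1 + i3 + 1) = l + 1 by rewrite -e -e12; ring.
  rewrite (br_leibniz f12 erefl e23 (deg_def3 e') f13 (deg_def1 e)).
  rewrite (br_leibniz_l e12 erefl f23 (deg_def2 e') f13 (deg_def3 e)).
  rewrite !(gmulDl, gmulDr, gmulZl, gmulZr).
  rewrite (gmulA _ _ e23 (deg_def1 e')).
  rewrite (gmulA _ _ (deg_def1 e23) (deg_def2 e')).
  rewrite (gmulA _ _ (deg_def2 e23) (deg_def2 e')).
  have -> : (-1) ^ i12 = (-1) ^ i1 * (-1) ^ i2 :> k by rewrite -e12 sgnD.
  have -> : (-1) ^ ((i1 - 1) * i2) = (-1) ^ i2 * (-1) ^ (i1 * i2) :> k.
    by rewrite -sgnD; apply: (@sgn_parity _ (- i2)); ring.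
  rewrite !scalerDr !scalerA !addrA !mulrA.
  by rewrite (br_irr _ f12) (br_irr _ f23) (ACl (1*2*4*5*3*6)).
- move=> i e U [x u]; rewrite /def_mul /= gmul1l expr0z scale1r gmul0l add0r.
  by rewrite br1l addr0 gmul1l.
- move=> i e U [x u]; rewrite /def_mul /= gmul1r gmul0r add0r br1r scaler0.
  by rewrite addr0; congr (_, _); move: (deg_def1 e) => e1; rewrite gmul1r.
Defined.
End Deformation.

(** * BV operators as sections of the deformation *)

Section BVSections.
Variable G : gerstenhaber k T.

Definition def_fst : gralg_morph (deformation G) G.
Proof.
exists (fun i => @Defs.Hom _ _ (deformation G i) (G i) (fun U p => p.1)
  (fun U c u v => erefl) (fun U V h s => erefl)); by [].
Defined.

Definition def_snd (i : int) : shom (deformation G i) (G (i + 1)) :=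
  @Defs.Hom _ _ (deformation G i) (G (i + 1)) (fun U p => p.2)
  (fun U c u v => erefl) (fun U V h s => erefl).

Definition def_pair (F : sheaf k T) (i : int) (f : shom F (G i))
    (g : shom F (G (i + 1))) : shom F (deformation G i).
Proof.
exists (fun U s => (f U s, g U s)).
  by move=> U c u v; rewrite !hom_linear.
by move=> U V h s; rewrite !hom_res.
Defined.

(** The deformation only offers the literal degree i + 1; matching on [e] reaches an arbitrary
    target degree j. *)
Definition bv_hom (phi : gralg_morph G (deformation G)) (i j : int)
    (e : i + 1 = j) : shom (G i) (G j) :=
  match e in _ = j return shom (G i) (G j) with
  | erefl => hom_comp (def_snd i) (phi i)
  end.

Definition bv_of_section (phi : gralg_morph G (deformation G))
    (phi_fst : forall i U (x : G i U), (phi i U x).1 = x) : bv_operator G.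
Proof.
exists (bv_hom phi) => i j i' j' n l eij ebr ei ej en ei'j eij' U a b.
case: n / eij en => en; case: l / en ebr ei'j eij' => ebr.
case: i' / ei; case: j' / ej => ei'j eij' /=.
(* The second component of multiplicativity of [phi] is the BV identity up to moving terms
   across. *)
rewrite gmorphM /= !phi_fst scalerDr (gmul_irr (deg_def1 _) ei'j).
rewrite (gmul_irr (deg_def2 _) eij') (br_irr (deg_def3 _) ebr).
by rewrite [X in X - _ - _]addrC addrK [RHS]addrC addKr.
Defined.

Lemma bvdM (d : bv_operator G) (i j i' j' n l : int) (eij : i + j = n)
    (ebr : i + j + 1 = l) (ei : i + 1 = i') (ej : j + 1 = j') (en : n + 1 = l)
    (ei'j : i' + j = l) (eij' : i + j' = l) U (a : G i U) (b : G j U) :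
  d n l en U (gmul eij a b) =
    gmul ei'j (d i i' ei U a) b
    + (-1) ^ i *: (gmul eij' a (d j j' ej U b) + br ebr a b).
Proof.
rewrite scalerDr (bvdP d eij ebr ei ej en ei'j eij').
by rewrite [X in _ + X]addrC subrK addrC subrK.
Qed.

Lemma bv_operator_eq (d d' : bv_operator G) :
  (forall i U (x : G i U), d i (i + 1) erefl U x = d' i (i + 1) erefl U x) ->
  d = d'.
Proof.
case: d d' => [d hd] [d' hd'] /= dd'.
have e : d = d'.
  apply: functional_extensionality_dep => i.
  apply: functional_extensionality_dep => j.
  apply: functional_extensionality_dep => e; case: j / e.
  by apply: shom_eq => U s; exact: dd'.
by case: d' / e hd' dd' => hd' _; congr BVOperator; exact: Prop_irrelevance.
Qed.

End BVSections.
End GerstenhaberCalculus.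

(** * The Schouten algebra *)

Section ExteriorAlgebra.
Context (k : fieldType) (T : topologicalType) (A : gerstenhaber k T).
Context (S : schouten A).
Implicit Types (U V W : opens T).

(** Both [f] and [g] solve the universal problem posed by the restriction of [f] to A. *)
Lemma ext_unique (B : gralg k T) (f g : gralg_morph S B) :
  is_exterior_map (hom_comp (f 0) (sch0 S)) (hom_comp (f (-1)) (sch1 S)) ->
  (forall U (a : A 0 U), f 0 U (sch0 S U a) = g 0 U (sch0 S U a)) ->
  (forall U (t : A (-1) U), f (-1) U (sch1 S U t) = g (-1) U (sch1 S U t)) ->
  f = g.
Proof.
move=> hf fg0 fg1; have [_ /(_ B _ _ hf)] := sch_ext S.
case=> h [_ h_uniq]; rewrite -(h_uniq f) // -(h_uniq g) //.
by split=> *; rewrite /= ?fg0 ?fg1.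
Qed.

Lemma ext_endo_id (f : gralg_morph S S) :
  (forall U (a : A 0 U), f 0 U (sch0 S U a) = sch0 S U a) ->
  (forall U (t : A (-1) U), f (-1) U (sch1 S U t) = sch1 S U t) ->
  forall n U (x : S n U), f n U x = x.
Proof.
move=> f0 f1 n U x; have [[h0 h00 h0n h01 h11] _] := sch_ext S.
suff -> : f = gr_id S by [].
apply: ext_unique => //; split=> /=.
- by move=> V; rewrite f0.
- by move=> *; rewrite !f0.
- by move=> *; rewrite !f0.
- by move=> *; rewrite !f0 !f1.
- by move=> *; rewrite !f1.
Qed.

(** The universal property maps S into the subalgebra cut out by P; followed by the inclusion, this
    fixes A, hence is the identity of S. *)
Lemma ext_subalg_ind (P : subfamily S) : subfamily_alg P ->
  (forall U (a : A 0 U), P 0 U (sch0 S U a)) ->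
  (forall U (t : A (-1) U), P (-1) U (sch1 S U t)) ->
  forall n U (x : S n U), P n U x.
Proof.
move=> hP P0 P1.
pose f0 : shom (A 0) (sub_gralg hP 0) := sub_lift P0.
pose f1 : shom (A (-1)) (sub_gralg hP (-1)) := sub_lift P1.
have [[h0 h00 h0n h01 h11] univ] := sch_ext S.
have hf : is_exterior_map f0 f1.
  split.
  - by move=> U; apply: sm_val_inj; rewrite /= h0.
  - by move=> e U a b; apply: sm_val_inj; rewrite /= h00.
  - by move=> n e e' U a x; apply: sm_val_inj; rewrite /=; exact: h0n.
  - by move=> e U a t; apply: sm_val_inj; rewrite /= h01.
  - by move=> l e U t; apply: sm_val_inj; rewrite /= h11.
have [phi [[phi0 phi1] _]] := univ _ _ _ hf.
move=> n U x.
rewrite -(@ext_endo_id (gr_comp (sub_incl hP) phi) _ _ n U x) /=.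
- exact: sm_valP.
- by move=> V a; rewrite /= phi0.
- by move=> V t; rewrite /= phi1.
Qed.

(* The sections y such that multiplication by y preserves P form a subalgebra
   containing A, hence are all of S. *)
Section ModuleInduction.
Variable P : forall n U, S n U -> Prop.
Hypothesis P_0 : forall n U, P (0 : S n U).
Hypothesis P_lin : forall n U c (x y : S n U), P x -> P y -> P (c *: x + y).
Hypothesis P_loc : forall n U (I : Type) (V : I -> opens T)
  (hV : forall i, V i `<=` U) (x : S n U),
  covers U V -> (forall i, P (res (hV i) x)) -> P x.

(** P need not be stable under restriction; Q is, by construction. *)
Let Q n U (x : S n U) := forall V (h : V `<=` U), P (res h x).

Let Q0 n U : Q (0 : S n U).
Proof. by move=> V h; rewrite res0. Qed.

Let Q_lin n U c (x y : S n U) : Q x -> Q y -> Q (c *: x + y).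
Proof. by move=> hx hy V h; rewrite res_linear; apply: P_lin. Qed.

Let Q_res n U V (h : V `<=` U) (x : S n U) : Q x -> Q (res h x).
Proof.
by move=> hx W h'; rewrite (res_comp _ _ (subset_trans h' h)).
Qed.

Let Q_loc n U (I : Type) (V : I -> opens T)
  (hV : forall i, V i `<=` U) (x : S n U) :
  covers U V -> (forall i, Q (res (hV i) x)) -> Q x.
Proof.
move=> cov hx W h.
have hW i : opens_I W (V i) `<=` W by move=> y [].
have hWV i : opens_I W (V i) `<=` V i by move=> y [].
apply: (P_loc (hV := hW)) => [y Wy|i].
  by have [i Vy] := cov y (h y Wy); exists i.
rewrite (res_comp _ _ (subset_trans (hW i) h)).
by rewrite -(res_comp (hV i) (hWV i)); apply: hx.
Qed.

(** Ranging over all smaller opens makes the condition stable under restriction; ranging over all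
    degrees m lets two multiplications be composed. *)
Let M_set n U (y : S n U) := forall V (h : V `<=` U) m l (e : n + m = l)
  (x : S m V), Q x -> Q (gmul e (res h y) x).

Let M_sub n U : submod (S n U).
Proof.
exists (@M_set n U).
  by move=> V h m l e x hx; rewrite res0 gmul0l; exact: Q0.
move=> c y z hy hz V h m l e x hx; rewrite res_linear gmul_linear_l.
by apply: Q_lin; [apply: hy|apply: hz].
Defined.

Let M : subfamily S.
Proof.
exists M_sub => [n U V h y hy W h' m l e x hx|].

  by rewrite (res_comp _ _ (subset_trans h' h)); apply: hy.
move=> n U I V hV y cov hy W h m l e x hx.
have hW i : opens_I W (V i) `<=` W by move=> z [].
have hWV i : opens_I W (V i) `<=` V i by move=> z [].
apply: (Q_loc (hV := hW)) => [z Wz|i].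
  by have [i Vz] := cov z (h z Wz); exists i.
rewrite gmul_res (res_comp _ _ (subset_trans (hW i) h)).
by rewrite -(res_comp (hV i) (hWV i)); apply: hy; apply: Q_res.
Defined.

(** Replaces induction over sums of wedge products: S is a sheafification, so such expressions exist
    only locally, and [P_loc] accounts for this. *)
Lemma ext_module_ind :
  (forall U, P (gone S U)) ->
  (forall n U (a : A 0 U) (x : S n U), P x ->
     P (gmul (deg_add0 n) (sch0 S U a) x)) ->
  (forall n U (t : A (-1) U) (x : S (n + 1) U), P x ->
     P (gmul (deg_lower n) (sch1 S U t) x)) ->
  forall n U (x : S n U), P x.
Proof.
move=> P1 Pa Pt n U x.
have hM : subfamily_alg M.
  split=> [U' V h m l e y hy|i j l e U' a b ha hb V h m l' e' y hy].
    have em : m = l by rewrite -e add0r.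
    by case: l / em e => e; rewrite gone_res gmul1l.
  have e2 : i + (j + m) = l' by rewrite addrA e.
  by rewrite gmul_res (gmulA _ _ erefl e2); apply: ha; apply: hb.
have Q1 : Q (gone S U) by move=> V h; rewrite gone_res.
(* Multiplication by x preserves Q, and 1 lies in Q, so x = x * 1 satisfies P. *)
have := ext_subalg_ind hM _ _ x; move=> /(_ _ _ U _ 0 n (addr0 n) _ Q1).
move=> /(_ _ _ (@subset_refl _ _) _ (@subset_refl _ _)).
rewrite gmul1r !res_id; apply.
  move=> U' a V h m l e y hy W h'.
  have em : m = l by rewrite -e add0r.
  case: l / em e => e; rewrite gmul_res -!hom_res (gmul_irr e (deg_add0 m)).
  exact: Pa.
move=> U' a V h m l e y hy W h'.
have em : l + 1 = m by lia.
case: m / em e y hy => e y hy; rewrite gmul_res -!hom_res.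
by rewrite (gmul_irr e (deg_lower l)); apply: Pt.
Qed.

End ModuleInduction.
End ExteriorAlgebra.

(** * The Schouten algebra in degrees at least 0 *)

Section LowDegrees.
Context (k : fieldType) (T : topologicalType) (A : gerstenhaber k T).
Context (S : schouten A) (hA : in_degrees_m1_0 A).
Implicit Types (U V W : opens T).

(* A is itself a graded algebra, because it lives in degrees -1 and 0. *)
Lemma sch_retraction : exists r : gralg_morph S A,
  (forall U (a : A 0 U), r 0 U (sch0 S U a) = a) /\
  (forall U (t : A (-1) U), r (-1) U (sch1 S U t) = t).
Proof.
have [_ univ] := sch_ext S.
have [|r [hr _]] := univ A (hom_id (A 0)) (hom_id (A (-1))); last by exists r.
split=> //= [n e e' U a x|l e U t]; first by rewrite (gcomm e e') mul0r scale1r.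
by apply: (hA (n := l)); rewrite -e.
Qed.

Lemma sch0_inj U : injective (@hom_fun _ _ _ _ (sch0 S) U).
Proof.
have [r [r0 _]] := sch_retraction.
by move=> a b /(congr1 (r 0 U)); rewrite !r0.
Qed.

(** S is generated from 1, in degree 0, by multiplications that never raise the degree. *)
Lemma sch_pos n : 0 < n -> forall U (x : S n U), x = 0.
Proof.
move=> n_gt0 U x; move: n_gt0.
apply: (@ext_module_ind _ _ _ S (fun n U x => 0 < n -> x = 0)) => //.
- by move=> {x}n V c x y hx hy n0; rewrite hx // hy // scaler0 addr0.
- move=> {x}n V I W hW x cov hx n0; apply: (sheaf_sep (hV := hW)) => // i.
  by rewrite hx // res0.
- by move=> {x}n V a x hx n0; rewrite hx // gmul0r.
by move=> {x}n V t x hx n0; rewrite hx ?gmul0r //; lia.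
Qed.

Lemma sch0_surj U (x : S 0 U) : exists a, sch0 S U a = x.
Proof.
(* The induction runs over all degrees, so the claim about degree 0 is transported along 0 = n. *)
pose P n V (y : S n V) :=
  forall e : 0 = n, exists a, ecast m (S m V) e (sch0 S V a) = y.
suff : P 0 U x by move/(_ erefl).
apply: (@ext_module_ind _ _ _ S P) => {x}.
- by move=> n V e; exists 0; case: n / e => /=; rewrite hom0.
- move=> n V c x y hx hy e; have [a ha] := hx e; have [b hb] := hy e.
  exists (c *: a + b); case: n / e x y hx hy ha hb => x y _ _ /= <- <-.
  exact: hom_linear.
- move=> n V I W hW x cov hx e; case: n / e x hx => x hx /=.
  pose a i := sval (cid (hx i erefl)).
  have ha i : sch0 S (W i) (a i) = res (hW i) x := svalP (cid (hx i erefl)).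
  have [|t ht] := sheaf_glue (s := a) hW cov.
    (* The chosen local preimages agree on overlaps because preimages are unique. *)
    move=> i j Z hi hj; apply: sch0_inj; rewrite !hom_res !ha.
    by rewrite !(res_comp _ _ (subset_trans hi (hW i))).
  exists t; apply: (sheaf_sep (hV := hW)) => // i.
  by rewrite -hom_res ht ha.
- move=> V e; exists (gone A V); rewrite (eq_irrelevance e erefl) /=.
  by have [[]] := sch_ext S.
- move=> n V a x hx e; have [b hb] := hx e; case: n / e x hx hb => x _ /= <-.
  by exists (gmul (deg_add0 0) a b); have [[_ ->]] := sch_ext S.
(* A product of t and x in degree 0 has x in degree 1, hence is zero. *)
move=> n V t x _ e; exists 0; have n1 : 0 < n + 1 by lia.
rewrite (sch_pos n1 x) gmul0r; case: _ / e => /=.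
by rewrite hom0.
Qed.

End LowDegrees.

(** * Lifting a right connection to the deformation *)

Section Extension.
Context (k : fieldType) (hk : [pchar k] =i pred0).
Context (T : topologicalType) (A : gerstenhaber k T).
Context (S : schouten A).
Implicit Types (U V W : opens T).

(** Characteristic zero enters here, through 2 being nonzero in k. *)
Lemma eq_opp0 (V : lmodType k) (x : V) : x = - x -> x = 0.
Proof.
move=> xN; have : (2%:R : k) *: x = 0 by rewrite scaler_nat mulr2n {1}xN addNr.
move/eqP; rewrite scaler_eq0 => /orP[|/eqP //].
by have := hk 2; rewrite !inE /= => ->.
Qed.

(** On degree -1 the bracket is antisymmetric without extra sign. The vanishing is needed for the
    lift of t to square to zero in the deformation. *)
Lemma br_diag (G : gerstenhaber k T) (l : int) (e : -1 + -1 + 1 = l) U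
  (t : G (-1) U) : br e t t = 0.
Proof.
apply: eq_opp0; rewrite {1}(br_antisym e e) (@sgn_parity _ 2 _ 0 erefl).
by rewrite expr0z scale1r.
Qed.

Variable nb : right_conn A.

Definition ext0 : shom (A 0) (deformation S 0) :=
  def_pair (sch0 S) (hom_zero (A 0) (S (0 + 1))).

Definition ext1 : shom (A (-1)) (deformation S (-1)) :=
  def_pair (sch1 S) (hom_comp (sch0 S) nb).

Lemma ext_is_exterior_map : is_exterior_map ext0 ext1.
Proof.
have [[h0 h00 h0n h01 h11] _] := sch_ext S; split.
- by move=> U; congr (_, _); rewrite /= h0.
- move=> e U a b; congr (_, _); first exact: h00.
  by rewrite [LHS]sch_pos //; symmetry; exact: sch_pos.
- move=> n e e' U a [y v]; congr (_, _) => /=; first exact: h0n.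
  (* There remains av + [a, y] against va + (-1)^n [y, a]; antisymmetry matches the brackets. *)
  rewrite gmul0l add0r expr0z scale1r gmul0r add0r.
  have e1 : n + 1 + 0 = n + 1 by lia.
  have e2 : 0 + n + 1 = n + 1 by lia.
  have e3 : n + 0 + 1 = n + 1 by lia.
  rewrite (h0n _ _ e1); congr (_ + _); last first.
    rewrite (br_antisym _ e3) -scaleNr -sgnS (br_irr e3 (deg_def3 e')).
    congr (_ *: _).
    by apply: (@sgn_parity _ (1 - n)); ring.
  exact: gmul_irr.
(* The second component of (a, 0)(t, nb t) is a nb(t) + [a, t] = a nb(t) - t(a): exactly the right
   Leibniz rule. *)
- move=> e U a t; congr (_, _); first exact: h01.
  rewrite /= gmul0l add0r expr0z scale1r.
  have e0 : -1 + 0 + 1 = 0 :> int by [].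
  rewrite (nablaP nb _ (addr0 0) e0) homB (sch_br10 S e0) h00.
  rewrite [X in _ = _ + X]br01 (br_irr e0 (deg_brt 0)).
  by congr (_ - _); exact: gmul_irr.
(* The second component of the square is nb(t) t - t nb(t) - [t, t]. *)
- move=> l e U t; congr (_, _); first exact: h11.
  rewrite /= br_diag addr0.
  case: l / e; rewrite (@sgn_parity _ (-1) _ 1 erefl) expr1z scaleN1r.
  by apply/eqP; rewrite subr_eq0; apply/eqP; exact: (h0n (-1)).
Qed.

End Extension.

(** * BV operators on the Schouten algebra *)

Section Operators.
Context (k : fieldType) (T : topologicalType) (A : gerstenhaber k T).
Context (S : schouten A).
Implicit Types (U V W : opens T) (d : bv_operator S).

Notation dd d n := (d n (n + 1) erefl).

Lemma bvd_irr d i j (e e' : i + 1 = j) U (x : S i U) :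
  d i j e U x = d i j e' U x.
Proof. by rewrite (Prop_irrelevance e e'). Qed.

Lemma bvd_deg0 d U (a : S 0 U) : dd d 0 U a = 0.
Proof. exact: sch_pos. Qed.

Lemma br_deg00 U (a b : S 0 U) : br (deg_bra 0) a b = 0.
Proof. exact: sch_pos. Qed.

Lemma bvd_mul0 d n U (a : S 0 U) (x : S n U) :
  dd d n U (gmul (deg_add0 n) a x) =
    gmul (deg_add0 (n + 1)) a (dd d n U x) + br (deg_bra n) a x.
Proof.
have e : 0 + 1 + n = n + 1 by ring.
rewrite (bvdM d (deg_add0 n) (deg_bra n) erefl erefl erefl e
  (deg_add0 (n + 1))).
by rewrite bvd_deg0 gmul0l add0r expr0z scale1r.
Qed.

Lemma bvd_mul1 d n U (t : S (-1) U) (x : S (n + 1) U) :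
  dd d n U (gmul (deg_lower n) t x) =
    gmul (deg_add0 (n + 1)) (d (-1) 0 deg_d1 U t) x
    - gmul (deg_lower (n + 1)) t (dd d (n + 1) U x) - br (deg_brt (n + 1)) t x.
Proof.
rewrite (bvdM d (deg_lower n) (deg_brt (n + 1)) deg_d1 erefl erefl
  (deg_add0 (n + 1)) (deg_lower (n + 1))).
by rewrite (@sgn_parity _ (-1) _ 1 erefl) expr1z scaleN1r opprD addrA.
Qed.

(** [bvd_mul0] and [bvd_mul1] compute d on a product from d on the right factor and the values on A
    of degree -1, so [ext_module_ind] applies. *)
Lemma bv_unique d d' :
  (forall U (t : A (-1) U),
     d (-1) 0 deg_d1 U (sch1 S U t) = d' (-1) 0 deg_d1 U (sch1 S U t)) ->
  d = d'.
Proof.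
move=> h; apply: bv_operator_eq.
apply: (@ext_module_ind _ _ _ S (fun n U x => dd d n U x = dd d' n U x)).
- by move=> n U; rewrite !hom0.
- by move=> n U c x y hx hy; rewrite !homD !homZ hx hy.
- move=> n U I V hV x cov hx; apply: (sheaf_sep (hV := hV)) => // i.
  by rewrite -!hom_res.
- by move=> U; rewrite !bvd_deg0.
- by move=> n U a x hx; rewrite !bvd_mul0 hx.
- by move=> n U t x hx; rewrite !bvd_mul1 hx h.
Qed.

(** * Flatness and the square of a BV operator *)

Section Square.
Variable d : bv_operator S.
Local Notation nb U t := (d (-1) 0 deg_d1 U t).
Local Notation T1 U t := (sch1 S U t).

(** In the expansion of d(d(tx)) the two terms nb(t) dx cancel and d(dx) vanishes; the identity is
    what is left. *)
Lemma bvd_sq0_brt :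
  (forall n U (x : S n U), dd d (n + 1) U (dd d n U x) = 0) ->
  forall n U (t : S (-1) U) (x : S (n + 1) U),
    dd d (n + 1) U (br (deg_brt (n + 1)) t x) =
      br (deg_bra (n + 1)) (nb U t) x
      + br (deg_brt (n + 1 + 1)) t (dd d (n + 1) U x).
Proof.
move=> dd0 n U t x; have := dd0 n U (gmul (deg_lower n) t x).
rewrite bvd_mul1 !homB bvd_mul0 bvd_mul1 dd0 gmul0r subr0 => /eqP.
rewrite subr_eq0 => /eqP <-.
by rewrite opprB addrA (ACl (1*4*2*3)) /= subrr add0r.
Qed.

Lemma bvd_sq0_br :
  (forall n U (x : S n U), dd d (n + 1) U (dd d n U x) = 0) ->
  forall U (s t : S (-1) U), nb U (br (deg_brt (-1)) s t) =
    br (deg_brt 0) s (nb U t) - br (deg_brt 0) t (nb U s).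
Proof.
move=> dd0 U s t; rewrite addrC.
rewrite -(@br01 _ _ S U _ t (deg_bra (-1))).
(* With n = -2 the second argument has degree n + 1 = -1. *)
have := bvd_sq0_brt dd0 (n := -2) s t.
by rewrite !(bvd_irr d deg_d1 (erefl 0 : -1 + 1 = 0 :> int)).
Qed.

Hypothesis flat : forall U (s t : A (-1) U),
  nb U (br (deg_brt (-1)) (T1 U s) (T1 U t)) =
    br (deg_brt 0) (T1 U s) (nb U (T1 U t))
    - br (deg_brt 0) (T1 U t) (nb U (T1 U s)).

Lemma bvd_brt n U (x : S n U) : forall t : A (-1) U,
  dd d n U (br (deg_brt n) (T1 U t) x) =
    br (deg_bra n) (nb U (T1 U t)) x
    + br (deg_brt (n + 1)) (T1 U t) (dd d n U x).
Proof.
move: n U x; apply: (@ext_module_ind _ _ _ S).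
- by move=> n U t; rewrite !(br0r, hom0) addr0.
- move=> n U c x y hx hy t; rewrite !(brDr, brZr, homD, homZ) hx hy.
  by rewrite scalerDr addrACA.
- move=> n U I V hV x cov hx t; apply: (sheaf_sep (hV := hV)) => // i.
  by rewrite resD -!hom_res !br_res -!hom_res hx.
- by move=> U t; rewrite !(br1r, br1l, bvd_deg0, br0r, hom0) addr0.
- move=> n U b x hx t; rewrite brt_gmul homD !bvd_mul0 hx brDr brt_gmul brt_br.
  rewrite bra_gmul0 ?br_deg00 // gmulDr !addrA.
  by rewrite (ACl (3*1*4*2*5)).
(* Flatness rewrites nb[t, s] as [t, nb s] - [s, nb t], and the Jacobi identity expands [t, [s, x]];
   the two sides then agree term by term. *)
- move=> n U s x hx t; rewrite brt_gmul homD !bvd_mul1 hx.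
  rewrite bra_gmul1 flat !brBr (brt_br (deg_brt (n + 1)) (T1 U t)).
  rewrite !brt_gmul gmulBl gmulDr !(opprD, opprB) !addrA.
  by rewrite (ACl (2*6*1*5*3*7*4*8)).
Qed.

(** As brackets within degree 0 vanish, [a, -] commutes with multiplication by b and anticommutes
    with [b, -]; the case of sx rests on the Jacobi identity for s, a, x. *)
Lemma bvd_bra n U (x : S n U) : forall a : S 0 U,
  dd d (n + 1) U (br (deg_bra n) a x) = - br (deg_bra (n + 1)) a (dd d n U x).
Proof.
move: n U x; apply: (@ext_module_ind _ _ _ S).
- by move=> n U a; rewrite !(br0r, hom0) oppr0.
- move=> n U c x y hx hy a; rewrite !(brDr, brZr, homD, homZ) hx hy.
  by rewrite scalerN opprD.
- move=> n U I V hV x cov hx t; apply: (sheaf_sep (hV := hV)) => // i.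
  by rewrite resN -!hom_res !br_res -!hom_res hx.
- by move=> U a; rewrite !(br1r, br1l, bvd_deg0, br0r, hom0) oppr0.
- move=> n U b x hx a; rewrite bra_gmul0 ?br_deg00 // !bvd_mul0 hx brDr.
  rewrite bra_gmul0 ?br_deg00 // gmulNr opprD; congr (_ + _).
  by rewrite (@bra_bra _ _ _ _ _ a) ?br_deg00 // opprK.
- move=> n U s x hx a; rewrite bra_gmul1 homB homN bvd_mul0 !bvd_mul1 hx.
  rewrite !brBr bra_gmul0 ?br_deg00 // bra_gmul1 (brt_br (deg_bra (n + 1))).
  rewrite gmulNr !(opprD, opprB, opprK) !addrA.
  by rewrite (ACl (2*5*3*1*4*6)) /= addNr add0r.
Qed.

Lemma bvd_sq0 n U (x : S n U) : dd d (n + 1) U (dd d n U x) = 0.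
Proof.
move: n U x; apply: (@ext_module_ind _ _ _ S).
- by move=> n U; rewrite !hom0.
- by move=> n U c x y hx hy; rewrite !(homD, homZ) hx hy scaler0 addr0.
- move=> n U I V hV x cov hx; apply: (sheaf_sep (hV := hV)) => // i.
  by rewrite res0 -!hom_res.
- by move=> U; rewrite bvd_deg0 hom0.
- move=> n U a x hx; rewrite bvd_mul0 homD bvd_mul0 bvd_bra hx gmul0r add0r.
  by rewrite subrr.
- move=> n U t x hx; rewrite bvd_mul1 !homB bvd_mul0 bvd_mul1 bvd_brt hx gmul0r.
  rewrite subr0 opprB opprD !addrA.
  by rewrite (ACl (1*4*2*5*3*6)) /= subrr add0r subrr add0r subrr.
Qed.

End Square.
End Operators.

(** * The explicit formula on wedge products *)

Section Formula.
Context (k : fieldType) (T : topologicalType) (A : gerstenhaber k T).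
Context (S : schouten A) (U : opens T).

Lemma gmul_swap11 (i l : int) (e : -1 + i = l) (m : int) (e' : -1 + l = m)
    (s t : S (-1) U) (w : S i U) :
  gmul e' s (gmul e t w) = - gmul e' t (gmul e s w).
Proof.
have e2 : -1 + -1 + i = m by lia.
rewrite -!(gmulA (erefl (-1 + -1)) e2).
rewrite (gcomm (erefl (-1 + -1)) (erefl (-1 + -1))).
by rewrite (@sgn_parity _ 0 _ 1 erefl) expr1z scaleN1r gmulNl.
Qed.

Lemma gmul_swap01 (i l : int) (e : -1 + i = l) 
    (a : S 0 U) (t : S (-1) U) (w : S i U) :
  gmul e t (gmul (deg_add0 i) a w) = gmul (deg_add0 l) a (gmul e t w).
Proof.
rewrite -(gmulA (addr0 (-1)) e) -(gmulA (deg_add0 (-1)) e).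
by rewrite (gcomm (addr0 (-1)) (deg_add0 (-1))) mulr0 expr0z scale1r.
Qed.

Lemma lift_lift0 p (j : 'I_p.+1) (m : 'I_p) :
  lift (lift ord0 j) (lift ord0 m) = lift ord0 (lift j m).
Proof. by apply: val_inj; rewrite /= !/bump /= add1n add1n ltnS addnS. Qed.

Lemma lift_ord0 p (j : 'I_p.+1) : lift (lift ord0 j) ord0 = ord0.
Proof. exact: val_inj. Qed.

Lemma wedgeS p (tau : 'I_p.+1 -> A (-1) U) :
  wedge S tau = gmul (deg_wedge p) (sch1 S U (tau ord0))
    (wedge S (fun m => tau (lift ord0 m))).
Proof. by []. Qed.

(** Bracketing with t is a derivation; moving the bracketed factor to the front past j others gives
    the sign (-1)^j. *)
Lemma br_wedge p (t : A (-1) U) (tau : 'I_p -> A (-1) U) :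
  br (deg_brt (- p%:Z)) (sch1 S U t) (wedge S tau) =
  \sum_(j < p) (-1) ^+ j *:
     gmul (deg_hat2 j) (sch1 S U (br deg_brT t (tau j)))
       (wedge S (fun m => tau (lift j m))).
Proof.
elim: p tau => [|p IH] tau; first by rewrite big_ord0; apply: br1r.
rewrite wedgeS brt_gmul IH big_ord_recl expr0 scale1r (br_irr _ deg_brT).
rewrite -sch_br11.
congr (_ + _); first exact: gmul_irr.
rewrite (lin_sum (gmul_linear_r _ _)).
(* Writing p as q + 1 exposes the head of the wedge from which an entry was removed. *)
case: p tau IH => [|q] tau _; first by rewrite !big_ord0.
apply: eq_bigr => j _; rewrite gmulZr exprS mulN1r scaleNr -scalerN.
congr (_ *: _); rewrite [wedge S _ in RHS]wedgeS lift_ord0.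
have -> : (fun m => tau (lift (lift ord0 j) (lift ord0 m))) =
    (fun m => tau (lift ord0 (lift j m))).
  by apply: funext => m; rewrite lift_lift0.
rewrite (gmul_irr (deg_hat2 j) (deg_wedge q)).
rewrite (gmul_irr (deg_hat2 (lift ord0 j)) (deg_wedge q.+1)).
exact: gmul_swap11.
Qed.

Lemma wedge_lift0 p (tau : 'I_p.+2 -> A (-1) U) (j : 'I_p.+1) :
  wedge S (fun m => tau (lift (lift ord0 j) m)) =
    gmul (deg_wedge p) (sch1 S U (tau ord0))
      (wedge S (fun m => tau (lift ord0 (lift j m)))).
Proof.
rewrite wedgeS lift_ord0; congr (gmul _ _ (wedge S _)).
by apply: funext => m; rewrite lift_lift0.
Qed.

(** For j > 0 the head tau_0 survives and passes the degree 0 coefficient freely, so the sign comes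
    only from the index shift. *)
Lemma formula_sum1 (nb : right_conn A) p (tau : 'I_p.+2 -> A (-1) U) :
  \sum_(j < p.+2) (-1) ^+ j *:
     gmul (deg_add0 (- p.+1%:Z)) (sch0 S U (nb U (tau j)))
       (wedge S (fun m => tau (lift j m))) =
  gmul (deg_add0 (- p.+1%:Z)) (sch0 S U (nb U (tau ord0)))
    (wedge S (fun m => tau (lift ord0 m)))
  - gmul (deg_wedge p) (sch1 S U (tau ord0))
     (\sum_(j < p.+1) (-1) ^+ j *:
       gmul (deg_add0 (- p%:Z)) (sch0 S U (nb U (tau (lift ord0 j))))
         (wedge S (fun m => tau (lift ord0 (lift j m))))).
Proof.
rewrite big_ord_recl expr0 scale1r (lin_sum (gmul_linear_r _ _)) -sumrN.
congr (_ + _); apply: eq_bigr => j _.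
by rewrite lift0 exprS mulN1r scaleNr gmulZr gmul_swap01 wedge_lift0.
Qed.

(** For 0 < i both indices shift, leaving the sign unchanged, and moving tau_0 past the bracket
    contributes the minus. The pairs with i = 0 form the second sum, which is the one in
    [br_wedge]. *)
Lemma formula_sum2 p (tau : 'I_p.+2 -> A (-1) U) :
  \sum_(j < p.+2) \sum_(i < p.+1 | (i < j)%N) (-1) ^+ (i + j) *:
     gmul (deg_hat2 i) (sch1 S U (br deg_brT (tau (lift j i)) (tau j)))
       (wedge S (fun m => tau (lift j (lift i m)))) =
  - gmul (deg_wedge p) (sch1 S U (tau ord0))
     (\sum_(j < p.+1) \sum_(i < p | (i < j)%N) (-1) ^+ (i + j) *:
       gmul (deg_hat2 i)
         (sch1 S U
           (br deg_brT (tau (lift ord0 (lift j i))) (tau (lift ord0 j))))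
         (wedge S (fun m => tau (lift ord0 (lift j (lift i m))))))
  - \sum_(j < p.+1) (-1) ^+ j *:
     gmul (deg_hat2 j) (sch1 S U (br deg_brT (tau ord0) (tau (lift ord0 j))))
       (wedge S (fun m => tau (lift ord0 (lift j m)))).
Proof.
rewrite big_ord_recl big1 // add0r (lin_sum (gmul_linear_r _ _)) -!sumrN.
rewrite -big_split; apply: eq_bigr => j _ /=.
(* Dropping the condition i < j temporarily allows i = 0 to be split off. *)
rewrite big_mkcond big_ord_recl -big_mkcond /= addrC; congr (_ + _).
  rewrite (lin_sum (gmul_linear_r _ _)) -sumrN.
  case: p tau j => [|q] tau j; first by rewrite !big_ord0.
  apply: eq_big => [i|i _]; first by rewrite /= /bump !add1n ltnS.
  rewrite /= /bump !add1n addSn addnS !exprS !mulN1r opprK lift_lift0 gmulZr.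
  rewrite -scalerN.
  congr (_ *: _); rewrite (gmul_irr (deg_hat2 i) (deg_wedge q)).
  rewrite (gmul_irr (deg_hat2 (lift ord0 i)) (deg_wedge q.+1)).
  rewrite -gmul_swap11 !lift_ord0; congr (gmul _ _ (gmul _ _ (wedge S _))).
  by apply: funext => m; rewrite !lift_lift0.
rewrite /= add0n /bump add1n exprS mulN1r scaleNr lift_ord0.
congr (- (_ *: _)); rewrite (gmul_irr _ (deg_hat2 j)).
by congr (gmul _ _ (wedge S _)); apply: funext => m; rewrite lift_lift0.
Qed.

Section Wedge.
Variables (d : bv_operator S) (nb : right_conn A).
Hypothesis d_nb : forall t : A (-1) U,
  d (-1) 0 deg_d1 U (sch1 S U t) = sch0 S U (nb U t).

Lemma bvd_wedge_cons p (t : S (-1) U) (w : S (- p.+1%:Z) U) :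
  d _ _ (deg_diff p.+1) U (gmul (deg_wedge p.+1) t w) =
    gmul (deg_add0 _) (d (-1) 0 deg_d1 U t) w
    - gmul (deg_wedge p) t (d _ _ (deg_diff p) U w) - br (deg_brt _) t w.
Proof.
rewrite (bvdM d (deg_wedge p.+1) (deg_brt _) deg_d1 (deg_diff p) (deg_diff p.+1)
  (deg_add0 _) (deg_wedge p)).
by rewrite (@sgn_parity _ (-1) _ 1 erefl) expr1z scaleN1r opprD addrA.
Qed.

(** Induction on p: the three terms of [bvd_wedge_cons] correspond to the pieces into which
    [formula_sum1] and [formula_sum2] split the formula. *)
Lemma bvd_wedge p (tau : 'I_p.+1 -> A (-1) U) :
  d _ _ (deg_diff p) U (wedge S tau) = bv_formula S nb tau.
Proof.
elim: p tau => [|p IH] tau.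
  have -> : wedge S tau = sch1 S U (tau ord0) by exact: gmul1r.
  rewrite /bv_formula !big_ord_recl !big_ord0 addr0 expr0 scale1r !addr0.
  rewrite (bvd_irr d _ deg_d1) d_nb; symmetry; exact: gmul1r.
rewrite wedgeS bvd_wedge_cons IH br_wedge d_nb.
rewrite /bv_formula gmulDr opprD formula_sum1 formula_sum2.
by rewrite !addrA.
Qed.
End Wedge.
End Formula.

(** * The correspondence between connections and BV operators *)

Section Correspondence.
Context (k : fieldType) (hk : [pchar k] =i pred0).
Context (T : topologicalType) (A : gerstenhaber k T).
Context (S : schouten A) (hA : in_degrees_m1_0 A).

Lemma ext_exists (nb : right_conn A) : exists d : bv_operator S,
  forall U (t : A (-1) U),
    d (-1) 0 deg_d1 U (sch1 S U t) = sch0 S U (nb U t).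
Proof.
have [_ univ] := sch_ext S.
have [phi [[phi0 phi1] _]] := univ _ _ _ (ext_is_exterior_map hk S nb).
(* The first projection after [phi] is an endomorphism of S fixing A, so [phi] is a section. *)
have phi_fst i U (x : S i U) : (phi i U x).1 = x.
  apply: (@ext_endo_id _ _ _ S (gr_comp (def_fst S) phi)) => V y /=.
    by rewrite phi0.
  by rewrite phi1.
exists (bv_of_section phi_fst) => U t.
rewrite (bvd_irr _ _ (erefl 0 : -1 + 1 = 0 :> int)) /=.
exact: (congr1 snd (phi1 U t)).
Qed.

(** In degree 0 the inclusion of A is bijective, with the retraction as inverse; since da = 0, the
    BV identity for a tau becomes the right Leibniz rule. *)
Lemma comp1_exists (d : bv_operator S) : exists nb : right_conn A,
  forall U (t : A (-1) U),
    sch0 S U (nb U t) = d (-1) 0 deg_d1 U (sch1 S U t).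
Proof.
have [r [r0 _]] := sch_retraction S hA.
have rK U (x : S 0 U) : sch0 S U (r 0 U x) = x.
  by have [a <-] := sch0_surj hA x; rewrite r0.
pose nb := hom_comp (r 0) (hom_comp (d (-1) 0 deg_d1) (sch1 S)).
have nbP (e : 0 + -1 = -1) (e0 : 0 + 0 = 0) (ebr : -1 + 0 + 1 = 0) U
    (a : A 0 U) (t : A (-1) U) :
  nb U (gmul e a t) = gmul e0 a (nb U t) - br ebr t a.
  apply: (@sch0_inj _ _ _ S hA U); rewrite homB !rK.
  have [[_ h00 _ h01 _] _] := sch_ext S.
  rewrite h00 (sch_br10 S ebr) rK /= h01.
  have e1 : 1 + -1 = 0 :> int by [].
  rewrite (bvdM d e (deg_bra (-1)) (add0r 1) deg_d1 deg_d1 e1 e0).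
  have -> : d 0 1 (add0r 1) U (sch0 S U a) = 0 by exact: sch_pos.
  rewrite gmul0l add0r expr0z scale1r [X in _ + X]br01.
  by rewrite (br_irr ebr (deg_brt 0)).
by exists (RightConn nbP) => U t /=; rewrite rK.
Qed.

Lemma right_conn_eq (nb nb' : right_conn A) :
  (forall U t, nb U t = nb' U t) -> nb = nb'.
Proof.
case: nb nb' => [f fP] [g gP] /= fg.
have e : f = g by apply: shom_eq.
by case: g / e gP fg => gP _; congr RightConn; exact: Prop_irrelevance.
Qed.

Lemma integrable_right_conn_eq (nb nb' : integrable_right_conn A) :
  nb = nb' :> right_conn A -> nb = nb'.
Proof.
case: nb nb' => [f fP] [g gP] /= e.
by case: g / e gP => gP; congr IntegrableRightConn; exact: Prop_irrelevance.
Qed.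

Lemma bv_structure_eq (d d' : bv_structure S) :
  d = d' :> bv_operator S -> d = d'.
Proof.
case: d d' => [f fP] [g gP] /= e.
by case: g / e gP => gP; congr BVStructure; exact: Prop_irrelevance.
Qed.

Variables (d : bv_operator S) (nb : right_conn A).
Hypothesis d_nb : forall U (t : A (-1) U),
  d (-1) 0 deg_d1 U (sch1 S U t) = sch0 S U (nb U t).

(** Flatness passes between A and S along the injective [sch0]; [bvd_sq0] and [bvd_sq0_br] then give
    the two directions. *)
Lemma flat_sq0 : 
  (forall (e : -1 + -1 + 1 = -1) (e0 : -1 + 0 + 1 = 0) U (s t : A (-1) U),
    nb U (br e s t) = br e0 s (nb U t) - br e0 t (nb U s)) <->
  (forall i j l (e : i + 1 = j) (e' : j + 1 = l) U (a : S i U),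
    d j l e' U (d i j e U a) = 0).
Proof.
split=> [flat i j l e e' U a|sq0 e e0 U s t].
  case: j / e e' => e'; case: l / e'.
  apply: bvd_sq0 => V s t.
  rewrite -sch_br11 !d_nb -!sch_br10 -homB; congr (sch0 S V _); exact: flat.
apply: (@sch0_inj _ _ _ S hA U); rewrite homB !sch_br10 -!d_nb sch_br11.
rewrite (br_irr e (deg_brt (-1))) !(br_irr e0 (deg_brt 0)).
exact: bvd_sq0_br (fun n => sq0 n _ _ erefl erefl) U _ _.
Qed.

End Correspondence.

Theorem theorem4p14 (k : fieldType) (hk : [pchar k] =i pred0)
    (X : smooth_scheme k) (A : gerstenhaber k X) (hA : in_degrees_m1_0 A)
    (S : schouten A) :
  exists (comp1 : bv_operator S -> right_conn A)
         (ext : right_conn A -> bv_operator S),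
    [/\ forall (d : bv_operator S) (U : opens X) (tau : A (-1) U),
          sch0 S U (comp1 d U tau) = d (-1) 0 deg_d1 U (sch1 S U tau),
        forall (nb : right_conn A) (U : opens X) (p : nat)
          (tau : 'I_p.+1 -> A (-1) U),
          ext nb _ _ (deg_diff p) U (wedge S tau) = bv_formula S nb tau,
        cancel comp1 ext, cancel ext comp1
      & exists (comp1' : bv_structure S -> integrable_right_conn A)
               (ext' : integrable_right_conn A -> bv_structure S),
          [/\ forall d, comp1' d = comp1 d :> right_conn A,
              forall nb, ext' nb = ext nb :> bv_operator S,
              cancel comp1' ext' & cancel ext' comp1']].
Proof.
have [comp1 comp1E] := choice (comp1_exists hA (S := S)).
have [ext extE] := choice (ext_exists hk S).
have comp1K : cancel comp1 ext.
  by move=> d; apply: bv_unique => U t; rewrite extE comp1E.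
have extK : cancel ext comp1.
  move=> nb; apply: right_conn_eq => U t; apply: (@sch0_inj _ _ _ S hA U).
  by rewrite comp1E extE.
exists comp1, ext; split=> //; first by move=> nb U p tau; exact: bvd_wedge.
(* The restricted maps keep the same underlying data and only attach the proof from [flat_sq0]. *)
pose comp1' (d : bv_structure S) : integrable_right_conn A :=
  IntegrableRightConn
    ((flat_sq0 hA (fun U t => esym (comp1E d U t))).2 (@bvs_sq0 _ _ _ d)).
pose ext' (nb : integrable_right_conn A) : bv_structure S :=
  BVStructure ((flat_sq0 hA (extE nb)).1 (@irc_flat _ _ _ nb)).
exists comp1', ext'; split=> // [d|nb].
  by apply: bv_structure_eq; exact: comp1K.
by apply: integrable_right_conn_eq; exact: extK.
Qed.
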